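(* There are absolute constants $c, C>0$ such that for every integer $d \geq 4$ there exists a set $\mathcal{H}$ of hyperplanes in $\mathbb{R}^d$ with $$c\, d^2 \log d \;\leq\; \operatorname{vcdim}\left(\Delta(\mathcal{H})\right) \;\leq\; C\, d^2\log d,$$ i.e. $\operatorname{vcdim}(\Delta(\mathcal{H})) = \Theta(d^2 \log d)$.
   Context: For a set $\mathcal{H}$ of hyperplanes in $\mathbb{R}^d$, define the set system on ground set $\mathcal{H}$ $$\Delta(\mathcal{H}) = \{ H \subseteq \mathcal{H} : \text{there is an open } d\text{-dimensional simplex } \Delta \subset \mathbb{R}^d \text{ such that } H = \{h \in \mathcal{H} : h \cap \Delta \neq \emptyset\}\}.$$ For a set system $(X,\mathcal{R})$ and $Y \subseteq X$, $\mathcal{R}$ shatters $Y$ if $\{Y \cap R : R \in \mathcal{R}\}$ is the full power set of $Y$; $\operatorname{vcdim}(\mathcal{R})$ is the largest size of a subset of $X$ shattered by $\mathcal{R}$. Logarithms are base 2. *)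

(* Defs.v *)
From HB Require Import structures.
From Stdlib Require Import Rdefinitions Rpower.
From mathcomp Require Import all_boot all_order all_algebra.
From mathcomp Require Import Rstruct.
Set Implicit Arguments. Unset Strict Implicit. Unset Printing Implicit Defensive.
Import Order.TTheory GRing.Theory Num.Theory.
Local Open Scope ring_scope.

Notation R := Rdefinitions.R.

Definition point (d : nat) := 'rV[R]_d.

Definition dotp d (u v : point d) : R := \sum_(i < d) u 0 i * v 0 i.

Definition is_hyperplane d (h : point d -> Prop) : Prop :=
  exists (a : point d) (b : R), a != 0 /\ forall x, h x <-> dotp a x = b.

Definition aff_indep d (v : 'I_d.+1 -> point d) : Prop :=
  forall mu : 'I_d.+1 -> R,
    \sum_i mu i = 0 -> \sum_i mu i *: v i = 0 -> forall i, mu i = 0.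

Definition open_simplex_of d (v : 'I_d.+1 -> point d) (x : point d) : Prop :=
  exists lam : 'I_d.+1 -> R,
    (forall i, 0 < lam i) /\ \sum_i lam i = 1 /\ x = \sum_i lam i *: v i.

Definition is_open_simplex d (D : point d -> Prop) : Prop :=
  exists v : 'I_d.+1 -> point d, aff_indep v /\ forall x, D x <-> open_simplex_of v x.

Definition meets d (h D : point d -> Prop) : Prop := exists x, h x /\ D x.

(* Y (a duplicate-free finite list of elements of H) is shattered by Delta(H):
   every subset P of Y is the trace on Y of {h in H : h meets Delta}
   for some open simplex Delta. *)
Definition simplex_shatters d (H : (point d -> Prop) -> Prop)
    (Y : list (point d -> Prop)) : Prop :=
  List.NoDup Y /\ (forall h, List.In h Y -> H h) /\
  forall P : (point d -> Prop) -> Prop,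
    exists D, is_open_simplex D /\
      forall h, List.In h Y -> (meets h D <-> P h).

Definition log2 (x : R) : R := Rpower.ln x / Rpower.ln 2.

(* Main.v *)
Require Import Defs.
From HB Require Import structures.
From Stdlib Require RIneq Rpower.
From mathcomp Require Import all_boot all_order all_algebra.
From mathcomp Require Import Rstruct boolp ring lra zify.
Import Order.TTheory GRing.Theory Num.Theory.
Local Open Scope ring_scope.
Set Implicit Arguments. Unset Strict Implicit. Unset Printing Implicit Defensive.

(* A hyperplane meets an open simplex iff it strictly separates two vertices, so a
   simplex with one vertex on the positive side of every hyperplane meets exactly
   those having another vertex on their negative side.  Since H may be taken finite,
   of size Theta(d^2 log d), it suffices to shatter it.

   Take k = 2^(n+1) <= d.  A butterfly network maps z in {0,1}^(n+1) to x(z) by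
   xoring bit i, for i = 0, 1, ..., with a switch s(i, x_0 .. x_(i-1), z_(i+1) .. z_n).
   The dyadic box of (i, w), w_i = 0, asks that x agrees with w up to position i and
   z agrees with w from position i on; it contains one of the k planar points
   (x(z), z) iff the switch s(i, w) is off.  The (n+1) 2^n switches being free, these
   boxes are shattered by k points of the plane.  Written in base 4, the boxes can be
   replaced by axis-parallel ellipses, which are half-spaces in the coordinates
   (X^2, X, Z^2, Z).  Placing floor(d/4) copies in disjoint blocks of four coordinates
   yields floor(d/4) (n+1) 2^n shattered hyperplanes; a small perturbation makes the
   vertices affinely independent. *)

(** * Hyperplanes meeting open simplices *)

Lemma dotp_sum d (I : finType) (a : point d) (c : I -> R) (v : I -> point d) :
  dotp a (\sum_i c i *: v i) = \sum_i c i * dotp a (v i).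
Proof.
rewrite /dotp; under [RHS]eq_bigr do rewrite mulr_sumr.
rewrite exchange_big /=; apply: eq_bigr => l _.
rewrite summxE mulr_sumr; apply: eq_bigr => i _.
by rewrite mxE mulrCA.
Qed.

(** Start from unit weights and raise one of them, at [q] if the sum of [F] is nonnegative and at
    [p] otherwise, until the weighted sum vanishes; then normalize. *)
Lemma positive_combination_eq0 (I : finType) (F : I -> R) (p q : I) :
  0 < F p -> F q < 0 ->
  exists lam : I -> R,
    [/\ forall i, 0 < lam i, \sum_i lam i = 1 & \sum_i lam i * F i = 0].
Proof.
move=> Fp Fq.
have [w w_gt0 wF] : exists2 w : I -> R, forall i, 0 < w i & \sum_i w i * F i = 0.
  have bump j : 0 <= - (\sum_i F i) / F j -> F j != 0 ->
      exists2 w : I -> R, forall i, 0 < w i & \sum_i w i * F i = 0.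
    move=> c_ge0 Fj.
    exists (fun i => 1 + (i == j)%:R * (- (\sum_i F i) / F j)) => [i|].
      by apply: ltr_wpDr => //; apply: mulr_ge0.
    under eq_bigr do rewrite mulrDl mul1r -mulrA mulr_natl mulrb.
    rewrite big_split /= -big_mkcond big_pred1_eq divfK //.
    exact: subrr.
  case: (leP 0 (\sum_i F i)) => S.
    by apply: (bump q); [rewrite mulNr oppr_ge0 mulr_ge0_le0// invr_le0 ltW | rewrite lt_eqF].
  by apply: (bump p); [rewrite divr_ge0 ?oppr_ge0 ?ltW | rewrite gt_eqF].
have W : 0 < \sum_i w i.
  by rewrite (bigD1 p) //= ltr_wpDr // sumr_ge0 // => i _; apply: ltW.
exists (fun i => w i / \sum_i w i); split=> [i||].
- exact: divr_gt0.
- by rewrite -mulr_suml divff // gt_eqF.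
- under eq_bigr do rewrite mulrAC.
  by rewrite -mulr_suml wF mul0r.
Qed.

Lemma meets_open_simplex d (a : point d) (b : R) (v : 'I_d.+1 -> point d) p :
  (forall i, dotp a (v i) - b != 0) -> 0 < dotp a (v p) - b ->
  meets (fun x => dotp a x = b) (open_simplex_of v) <->
  exists i, dotp a (v i) - b < 0.
Proof.
move=> nz gtp; split.
  move=> [x [ax [lam [lam_gt0 [lam1 xE]]]]]; apply: contrapT => allpos.
  have pos i : 0 < dotp a (v i) - b.
    by rewrite lt_neqAle eq_sym nz leNgt; apply/negP => lt0; apply: allpos; exists i.
  suff : 0 < dotp a x - b by rewrite ax subrr ltxx.
  rewrite xE dotp_sum -[b]mul1r -lam1 mulr_suml -sumrB (bigD1 p) //= -mulrBr.
  rewrite ltr_wpDr ?mulr_gt0 // sumr_ge0 // => i _.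
  by rewrite -mulrBr mulr_ge0 // ltW.
move=> [q ltq].
have [lam [lam_gt0 lam1 lamF]] :=
  @positive_combination_eq0 _ (fun i => dotp a (v i) - b) p q gtp ltq.
exists (\sum_i lam i *: v i); split; last by exists lam.
apply/eqP; rewrite dotp_sum -subr_eq0 -{1}[b]mul1r -lam1 mulr_suml -sumrB.
by under eq_bigr do rewrite -mulrBr; rewrite lamF.
Qed.

(** * Perturbation to affinely independent vertices *)

(* [det (A + t B)] is, up to a unit, a characteristic polynomial in [t]. *)
Lemma unitmx_perturb n (A B : 'M[R]_n) (e : R) :
  B \in unitmx -> 0 < e -> exists t, [/\ 0 < t, t < e & A + t *: B \in unitmx].
Proof.
move=> uB e_gt0; set p := char_poly (- (A *m invmx B)).
have p0 : p != 0 by apply: monic_neq0; apply: char_poly_monic.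
(* The nonzero [p] has fewer than [size p] roots, so one of these [size p] candidates below [e] is
   not a root. *)
pose rs : seq R := [seq e / j.+2%:R | j <- iota 0 (size p)].
have [|/allPn[t]] := boolP (all (root p) rs).
  move=> rootp; have := max_poly_roots p0 rootp; rewrite size_map size_iota ltnn.
  suff -> : uniq rs by move/(_ isT).
  rewrite map_inj_uniq ?iota_uniq // => i j.
  by move/(mulfI (lt0r_neq0 e_gt0))/invr_inj/eqP; rewrite eqr_nat => /eqP[].
move=> /mapP[j _ ->{t}]; set t := e / _ => nroot.
exists t; split; first by rewrite divr_gt0.
  by rewrite ltr_pdivrMr ?ltr0n // ltr_pMr // ltr1n.
have -> : A + t *: B = - (- (A *m invmx B) - t%:M) *m B.
  by rewrite opprD !opprK mulmxDl mul_scalar_mx mulmxKV.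
rewrite unitmx_mul uB andbT -scaleN1r unitmxZ ?unitrN1 // -row_free_unit -kermx_eq0.
by move: nroot; rewrite -eigenvalue_root_char negbK.
Qed.

Lemma sign_stable (I : finType) (g h : I -> R) : (forall i, g i != 0) ->
  exists2 e, 0 < e & forall t, 0 < t -> t < e -> forall i, 0 < g i * (g i + t * h i).
Proof.
move=> nz; exists (\big[Num.min/1]_i (g i ^+ 2 / (`|g i * h i| + 1))).
  apply: lt_bigmin => // i _.
  by rewrite divr_gt0 ?exprn_even_gt0 ?nz // ltr_wpDl.
move=> t t0 te i; have := lt_le_trans te (bigmin_le _ i _).
rewrite ltr_pdivlMr ?ltr_wpDl // => lt_t.
have := ler_norm (- (g i * h i)); rewrite normrN => le_n.
have : t * - (g i * h i) <= t * `|g i * h i| by rewrite ler_pM2l.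
by nra.
Qed.

(** The vertices move slightly towards those of the standard simplex [w]. With a column of ones
    prepended, affine independence becomes invertibility of a matrix, which [unitmx_perturb]
    supplies; dividing by [1 + t] turns the column of [1 + t] back into ones. *)
Lemma aff_indep_perturb d (I : finType) (a : I -> point d) (b : I -> R)
    (v : 'I_d.+1 -> point d) :
  (forall r i, dotp (a r) (v i) - b r != 0) ->
  exists v', aff_indep v' /\
    forall r i, 0 < (dotp (a r) (v i) - b r) * (dotp (a r) (v' i) - b r).
Proof.
move=> nz.
pose w (i : 'I_d.+1) : point d := \row_l (i == lift ord0 l)%:R.
have [e e0 sgn] := @sign_stable _ (fun ri : I * 'I_d.+1 => dotp (a ri.1) (v ri.2) - b ri.1)
  (fun ri => dotp (a ri.1) (w ri.2) - b ri.1) (fun ri => nz _ _).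
pose M (u : 'I_d.+1 -> point d) : 'M[R]_(d.+1) :=
  \matrix_(i, j) if unlift ord0 j is Some l then u i 0 l else 1.
have uB : M w \in unitmx.
  rewrite unitmxE det_trig.
    apply/unitr_prodP => i _; rewrite mxE; case: unliftP => [l ->|_ _]; last exact: unitr1.
    by rewrite mxE eqxx unitr1.
  apply/is_trig_mxP => i j lt_ij; rewrite mxE; case: unliftP => [l jE|j0].
    by rewrite mxE -jE -val_eqE ltn_eqF.
  by rewrite j0 in lt_ij.
have [t [t0 te]] := unitmx_perturb (M v) uB e0 => uM.
have t1 : 1 + t != 0 by rewrite gt_eqF // ltr_wpDr // ltW.
pose v' i : point d := (1 + t)^-1 *: (v i + t *: w i).
exists v'; split=> [mu mu0 muv i|r i].
  suff /rowP/(_ i) : \row_j mu j = 0 by rewrite !mxE.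
  apply: (row_free_inj (_ : row_free (M v + t *: M w))); first by rewrite row_free_unit.
  rewrite mul0mx; apply/rowP => j; rewrite !mxE.
  case: (unliftP ord0 j) => [l jE|jE].
    transitivity ((1 + t) * (\sum_i mu i *: v' i) 0 l); last by rewrite muv mxE mulr0.
    rewrite summxE mulr_sumr; apply: eq_bigr => k _.
    by rewrite !mxE jE liftK !mxE; field.
  transitivity ((1 + t) * \sum_i mu i); last by rewrite mu0 mulr0.
  rewrite mulr_sumr; apply: eq_bigr => k _.
  by rewrite !mxE jE unlift_none; ring.
have -> : dotp (a r) (v' i) - b r =
    (1 + t)^-1 * ((dotp (a r) (v i) - b r) + t * (dotp (a r) (w i) - b r)).
  have -> : dotp (a r) (v' i) = (1 + t)^-1 * (dotp (a r) (v i) + t * dotp (a r) (w i)).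
    rewrite /dotp [t * _]mulr_sumr -big_split mulr_sumr; apply: eq_bigr => l _.
    by rewrite !mxE /=; ring.
  by field.
rewrite mulrCA mulr_gt0 ?invr_gt0 ?addr_gt0 //.
exact: (sgn t t0 te (r, i)).
Qed.

(** * Bit strings read in base 4 *)

Definition val4 N (f : 'I_N -> bool) : R := \sum_l (f l)%:R * 4 ^+ l.

Lemma val4_recr N (f : 'I_N.+1 -> bool) :
  val4 f = val4 (fun l => f (widen_ord (leqnSn N) l)) + (f ord_max)%:R * 4 ^+ N.
Proof. exact: big_ord_recr. Qed.

Lemma val4_ge0 N (f : 'I_N -> bool) : 0 <= val4 f.
Proof. by apply: sumr_ge0 => l _; rewrite mulr_ge0 // exprn_ge0. Qed.

(** Digits differ by at most 1, and the powers of 4 below [4 ^+ N] add up to a third of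
    [4 ^+ N - 1]. *)
Lemma val4_diff_bound N (f g : 'I_N -> bool) : 3 * `|val4 f - val4 g| <= 4 ^+ N - 1.
Proof.
elim: N f g => [|N IH] f g; first by rewrite /val4 !big_ord0 subrr normr0 mulr0 subrr.
rewrite !val4_recr; set x := val4 _; set y := val4 _.
have : 3 * `|x - y| <= 4 ^+ N - 1 by exact: IH.
have : 0 <= 4 ^+ N :> R by exact: exprn_ge0.
rewrite exprS; move: (4 ^+ N) => q q0; case: (ger0P (x - y)) => xy bxy.
all: by case: (f _); case: (g _); rewrite ?mul1r ?mul0r; case: ger0P; lra.
Qed.

(* Binary digits written in base 4 keep the gap between agreeing and differing
   above position [i]: the factor 2 is what lets an ellipse replace a box. *)
Lemma val4_diff_agree N (f g : 'I_N -> bool) i :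
  (forall l : 'I_N, (i <= l)%N -> f l = g l) -> 3 * `|val4 f - val4 g| < 4 ^+ i.
Proof.
elim: N f g => [|N IH] f g fg.
  by rewrite /val4 !big_ord0 subrr normr0 mulr0 exprn_gt0.
have [le_iN|lt_Ni] := leqP i N.
  rewrite !val4_recr (fg ord_max le_iN) opprD addrACA subrr addr0; apply: IH => l il.
  exact: fg.
apply: (le_lt_trans (val4_diff_bound f g)); rewrite ltrBlDr ltr_pwDr //.
by rewrite ler_eXn2l // ltr1n.
Qed.

(** The topmost differing digit contributes a full power of 4, of which the lower digits cancel less
    than a third. *)
Lemma val4_diff_differ N (f g : 'I_N -> bool) i (l : 'I_N) :
  (i <= l)%N -> f l != g l -> 2 * 4 ^+ i <= 3 * `|val4 f - val4 g|.
Proof.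
elim: N f g l => [|N IH] f g l il fg; first by case: l {il fg} => ?.
have [fgN|fgN] := eqVneq (f ord_max) (g ord_max).
  rewrite !val4_recr fgN opprD addrACA subrr addr0; case: (unliftP ord_max l) => [l' lE|lE].
    have wE : l = widen_ord (leqnSn N) l' by apply: val_inj; rewrite lE; exact: lift_max.
    by apply: (IH _ _ l'); rewrite -?wE // -[val l']/(val (widen_ord (leqnSn N) l')) -wE.
  by move: fg; rewrite lE fgN eqxx.
have le_iN : (i <= N)%N by apply: (leq_trans il); rewrite -ltnS.
have le4 : 4 ^+ i <= 4 ^+ N :> R by rewrite ler_eXn2l // ltr1n.
rewrite !val4_recr; set x := val4 _; set y := val4 _.
have : 3 * `|x - y| <= 4 ^+ N - 1 by exact: val4_diff_bound.
have : 0 <= 4 ^+ i :> R by exact: exprn_ge0.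
move: le4; move: (4 ^+ N) (4 ^+ i) => q p le4 p0; case: (ger0P (x - y)) => xy bxy.
all: by move: fgN; case: (f _); case: (g _); rewrite ?mul1r ?mul0r //= => _; case: ger0P; lra.
Qed.

(** * Butterfly networks *)

Definition ignores_own_bit N (s : 'I_N -> {ffun 'I_N -> bool} -> bool) :=
  forall i (t t' : {ffun 'I_N -> bool}),
    (forall l, l != i -> t l = t' l) -> s i t = s i t'.

(** Step [k'] changes at most bit [k']; at that time the bits below it are already output bits, the
    others still input bits. *)
Fixpoint butterfly N (s : 'I_N -> {ffun 'I_N -> bool} -> bool) (k : nat)
    (z : {ffun 'I_N -> bool}) : {ffun 'I_N -> bool} :=
  if k is k'.+1 then
    [ffun l => butterfly s k' z l (+) ((l == k' :> nat) && s l (butterfly s k' z))]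
  else z.

(** Each step is an involution, as its switch does not read the bit it flips; so the last step is
    undone by applying it to [w]. *)
Lemma butterfly_surj N (s : 'I_N -> {ffun 'I_N -> bool} -> bool) k w :
  ignores_own_bit s -> exists z, butterfly s k z = w.
Proof.
move=> s_indep.
elim: k w => [|k IH] w; first by exists w.
have [z zE] := IH [ffun l => w l (+) ((l == k :> nat) && s l w)].
exists z; apply/ffunP => l; rewrite /= zE !ffunE.
have [/= lk|/=] := eqVneq (l : nat) k; last by rewrite !addbF.
suff -> : s l [ffun l => w l (+) ((l == k :> nat) && s l w)] = s l w by rewrite addbK.
apply: s_indep => j; rewrite ffunE -val_eqE /= lk => /negPf ->.
by rewrite addbF.
Qed.

Lemma butterfly_late N (s : 'I_N -> {ffun 'I_N -> bool} -> bool) k z (l : 'I_N) :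
  (k <= l)%N -> butterfly s k z l = z l.
Proof.
elim: k => [//|k IH] lt_kl; rewrite ffunE IH ?(ltnW lt_kl) //.
by rewrite gtn_eqF // addbF.
Qed.

Lemma butterfly_early N (s : 'I_N -> {ffun 'I_N -> bool} -> bool) i j z (l : 'I_N) :
  (l < i)%N -> (i <= j)%N -> butterfly s j z l = butterfly s i z l.
Proof.
move=> lt_li; elim: j => [|j IH]; first by rewrite leqn0 => /eqP ->.
rewrite leq_eqVlt => /orP[/eqP -> //|]; rewrite ltnS => le_ij.
by rewrite ffunE IH // ltn_eqF ?addbF // (leq_trans lt_li).
Qed.

(* If [z] and its image agree with [w] above and below [i] respectively, then the
   intermediate state at time [i] is [w] itself, so only the switch [s i w] decides. *)
Lemma butterfly_hit N (s : 'I_N -> {ffun 'I_N -> bool} -> bool) (i : 'I_N)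
    (w : {ffun 'I_N -> bool}) :
  ignores_own_bit s ->
  (exists z : {ffun 'I_N -> bool}, (forall l : 'I_N, (i <= l)%N -> z l = w l) /\
             (forall l : 'I_N, (l <= i)%N -> butterfly s N z l = w l)) <->
  ~~ s i w.
Proof.
move=> s_indep.
have at_i z : butterfly s N z i = butterfly s i z i (+) s i (butterfly s i z).
  by rewrite (@butterfly_early N s i.+1) //= ffunE eqxx.
split=> [[z [zw xw]]|nsw].
  have bw : butterfly s i z = w.
    apply/ffunP => l; have [li|il] := ltnP l i.
      by rewrite -xw ?(ltnW li) // (butterfly_early _ _ li) // ltnW.
    by rewrite butterfly_late // zw.
  have := at_i z; rewrite xw // bw; by case: (w i); case: (s i w).
have [z zw] := butterfly_surj i w s_indep; exists z; split=> l.
  by move=> il; rewrite -zw butterfly_late.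
rewrite leq_eqVlt => /orP[/eqP/val_inj ->|li].
  by rewrite at_i zw (negPf nsw) addbF.
by rewrite (butterfly_early _ _ li) ?zw // ltnW.
Qed.

(** * Ellipses as half-spaces in four coordinates *)

(** The threshold 1/3 separates the two cases: inside, both squares are below 1/9; outside, one of
    them is at least 4/9. *)
Lemma ellipse_lt0 (x y p q : R) : 0 < p -> 0 < q ->
  3 * `|x| < p -> 3 * `|y| < q -> (x / p) ^+ 2 + (y / q) ^+ 2 - 3^-1 < 0.
Proof.
have sq (u v : R) : 0 < v -> 3 * `|u| < v -> 9 * (u / v) ^+ 2 < 1.
  move=> v0 uv; have : `|u / v| < 3^-1.
    by rewrite normrM normfV (gtr0_norm v0) ltr_pdivrMr //; lra.
  by rewrite -[_ ^+ 2]real_normK ?num_real //; have := normr_ge0 (u / v); nra.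
by move=> p0 q0 /(sq _ _ p0) ? /(sq _ _ q0) ?; lra.
Qed.

Lemma ellipse_gt0 (x y p q : R) : 0 < p -> 0 < q ->
  2 * p <= 3 * `|x| \/ 2 * q <= 3 * `|y| -> 0 < (x / p) ^+ 2 + (y / q) ^+ 2 - 3^-1.
Proof.
have sq (u v : R) : 0 < v -> 2 * v <= 3 * `|u| -> 4 <= 9 * (u / v) ^+ 2.
  move=> v0 uv; have : 2 / 3 <= `|u / v|.
    by rewrite normrM normfV (gtr0_norm v0) ler_pdivlMr //; lra.
  by rewrite -[_ ^+ 2]real_normK ?num_real //; nra.
move=> p0 q0 [/(sq _ _ p0)|/(sq _ _ q0)] ?;
  by have := sqr_ge0 (x / p); have := sqr_ge0 (y / q); lra.
Qed.

Lemma dotp_block d (b : nat) (g : nat -> R) (h : nat -> nat -> R) :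
  (4 * b.+1 <= d)%N ->
  dotp (\row_(l < d) ((l %/ 4 == b)%N%:R * g (l %% 4)%N)) (\row_(l < d) h (l %/ 4)%N (l %% 4)%N)
  = \sum_(k < 4) g k * h b k.
Proof.
move=> bd; rewrite /dotp; under eq_bigr do rewrite !mxE.
pose F l := (l %/ 4 == b)%N%:R * g (l %% 4)%N * h (l %/ 4)%N (l %% 4)%N.
rewrite -(big_mkord xpredT F) (big_cat_nat (n := 4 * b)) //=; last by lia.
rewrite [X in X + _]big_nat_cond big1 ?add0r; last first.
  by move=> l /andP[/andP[_ lb] _]; rewrite /F (_ : (l %/ 4 == b)%N = false) ?mul0r //; lia.
rewrite (big_cat_nat (n := 4 * b.+1)) //=; last by lia.
rewrite [X in _ + X]big_nat_cond [X in _ + X]big1 ?addr0; last first.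
  by move=> l /andP[/andP[lb _] _]; rewrite /F (_ : (l %/ 4 == b)%N = false) ?mul0r //; lia.
rewrite -[(4 * b)%N]add0n big_addn (_ : (4 * b.+1 - 4 * b = 4)%N); last by lia.
rewrite big_mkord; apply: eq_bigr => k _.
have qE : ((k + 4 * b) %/ 4 = b)%N by rewrite addnC mulnC divnMDl // divn_small // addn0.
have rE : ((k + 4 * b) %% 4 = k)%N by rewrite addnC mulnC modnMDl modn_small.
by rewrite /F qE rE eqxx mul1r.
Qed.

(** Strings differing only at [i] share a switch of level [i]; fixing that bit to 0 names each
    switch once. *)
Definition insert0 n (i : 'I_n.+1) (w : {ffun 'I_n -> bool}) : {ffun 'I_n.+1 -> bool} :=
  [ffun l => if unlift i l is Some l' then w l' else false].

Definition delete_bit n (i : 'I_n.+1) (t : {ffun 'I_n.+1 -> bool}) : {ffun 'I_n -> bool} :=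
  [ffun l => t (lift i l)].

Lemma insert0K n (i : 'I_n.+1) : cancel (insert0 i) (delete_bit i).
Proof. by move=> w; apply/ffunP => l; rewrite !ffunE liftK. Qed.

(* Each block [b < m] uses four coordinates of [R^d]; in a block, [(i, w)] is the
   box around the bit string [w] with a [0] inserted at position [i]. *)
Definition box_index m n := ('I_m * 'I_n.+1 * {ffun 'I_n -> bool})%type.

(** Reversal makes the first bits the most significant, so agreement up to position [i] means
    closeness. *)
Definition rval4 N (f : 'I_N -> bool) : R := val4 (fun l => f (rev_ord l)).

(** Coefficients of X^2, X, Z^2, Z in the expanded ellipse equation with right-hand side 1/3; the
    remaining constants go to [ellipse_const]. *)
Definition ellipse_coef n (i : 'I_n.+1) (w : {ffun 'I_n -> bool}) (k : nat) : R :=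
  let p : R := 4 ^+ rev_ord i in let q : R := 4 ^+ i in
  nth 0 [:: p ^- 2; - 2 * rval4 (insert0 i w) / p ^+ 2;
            q ^- 2; - 2 * val4 (insert0 i w) / q ^+ 2] k.

Definition ellipse_const n (i : 'I_n.+1) (w : {ffun 'I_n -> bool}) : R :=
  let p : R := 4 ^+ rev_ord i in let q : R := 4 ^+ i in
  3^-1 - (rval4 (insert0 i w) / p) ^+ 2 - (val4 (insert0 i w) / q) ^+ 2.

(* [P b] lies inside the ellipse of [(b, i, w)] iff the lifted point is on the
   negative side of the hyperplane with these coefficients. *)
Definition lift_point d m (P : 'I_m.+1 -> R * R) : point d :=
  \row_(l < d) nth 0 [:: (P (inord (l %/ 4)%N)).1 ^+ 2; (P (inord (l %/ 4)%N)).1;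
                         (P (inord (l %/ 4)%N)).2 ^+ 2; (P (inord (l %/ 4)%N)).2] (l %% 4)%N.

Definition normal_of d m n (r : box_index m n) : point d :=
  \row_(l < d) ((l %/ 4 == r.1.1)%N%:R * ellipse_coef r.1.2 r.2 (l %% 4)%N).

Lemma dotp_lift_point d m n (r : box_index m.+1 n) (P : 'I_m.+1 -> R * R) :
  (4 * m.+1 <= d)%N ->
  dotp (normal_of d r) (lift_point d P) - ellipse_const r.1.2 r.2 =
  (((P r.1.1).1 - rval4 (insert0 r.1.2 r.2)) / 4 ^+ rev_ord r.1.2) ^+ 2 +
  (((P r.1.1).2 - val4 (insert0 r.1.2 r.2)) / 4 ^+ r.1.2) ^+ 2 - 3^-1.
Proof.
move=> md; case: r => [[b i] w] /=.
rewrite (@dotp_block d b (ellipse_coef i w) (fun b' => nth 0 [:: (P (inord b')).1 ^+ 2;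
  (P (inord b')).1; (P (inord b')).2 ^+ 2; (P (inord b')).2])); last first.
  by apply: leq_trans md; rewrite leq_mul2l /= ltn_ord.
rewrite !big_ord_recl big_ord0 /= inord_val /ellipse_const /ellipse_coef /=.
have : 4 ^+ (n.+1 - i.+1) != 0 :> R by rewrite gt_eqF // exprn_gt0.
have : 4 ^+ i != 0 :> R by rewrite gt_eqF // exprn_gt0.
move: (4 ^+ i) (4 ^+ (n.+1 - i.+1)) => q p q0 p0.
by field; rewrite q0 p0.
Qed.

(** * Every trace is realized by a simplex *)

Lemma simplices_trace d m n (e : box_index m.+1 n -> bool) :
  (4 * m.+1 <= d)%N -> (2 ^ n.+1 <= d)%N ->
  exists v : 'I_d.+1 -> point d, aff_indep v /\
    forall r, meets (fun x => dotp (normal_of d r) x = ellipse_const r.1.2 r.2)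
                    (open_simplex_of v) <-> e r.
Proof.
move=> md nd.
(* A switch is off exactly when its box must be hit; deleting bit [i] makes it blind to that bit. *)
pose s b i t := ~~ e (b, i, delete_bit i t).
have s_indep b : ignores_own_bit (s b).
  move=> i t t' tt'; rewrite /s; congr (~~ e (b, i, _)).
  by apply/ffunP => l; rewrite !ffunE tt' // eq_sym neq_lift.
(* [None] is a common vertex outside all ellipses; it also pads the [2 ^ n.+1]
   queries to the [d.+1] vertices. *)
pose P (o : option {ffun 'I_n.+1 -> bool}) (b : 'I_m.+1) : R * R :=
  if o is Some z then (rval4 (butterfly (s b) n.+1 z), val4 z) else (- 4 ^+ n.+1, 0).
pose f o (r : box_index m.+1 n) :=
  dotp (normal_of d r) (lift_point d (P o)) - ellipse_const r.1.2 r.2.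
have p_gt0 k : 0 < 4 ^+ k :> R by rewrite exprn_gt0.
have f_None r : 0 < f None r.
  rewrite /f dotp_lift_point //; apply: ellipse_gt0; rewrite ?p_gt0 //; left.
  rewrite /P /= ler0_norm; last first.
    by rewrite subr_le0; apply: (le_trans _ (val4_ge0 _)); rewrite oppr_le0 ltW.
  have := val4_ge0 (fun l => insert0 r.1.2 r.2 (rev_ord l)); rewrite -/(rval4 _).
  have : 4 ^+ rev_ord r.1.2 <= 4 ^+ n.+1 :> R by rewrite ler_eXn2l ?ltr1n // leq_subr.
  have := p_gt0 n.+1; lra.
pose hit (z : {ffun 'I_n.+1 -> bool}) (r : box_index m.+1 n) :=
  (forall l : 'I_n.+1, (r.1.2 <= l)%N -> z l = insert0 r.1.2 r.2 l) /\
  (forall l : 'I_n.+1, (l <= r.1.2)%N -> butterfly (s r.1.1) n.+1 z l = insert0 r.1.2 r.2 l).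
have f_hit z r : hit z r -> f (Some z) r < 0.
  move=> [zw xw]; rewrite /f dotp_lift_point //=; apply: ellipse_lt0; rewrite ?p_gt0 //.
    apply: val4_diff_agree => l il; apply: xw => /=; move: il => /=; case: l => l /= ?; lia.
  exact: val4_diff_agree.
have f_miss z r : ~ hit z r -> 0 < f (Some z) r.
  move=> nhit; rewrite /f dotp_lift_point //=; apply: ellipse_gt0; rewrite ?p_gt0 //.
  have [/forallP zw|] := boolP [forall l : 'I_n.+1,
      (r.1.2 <= l)%N ==> (z l == insert0 r.1.2 r.2 l)].
    have [/forallP xw|] := boolP [forall l : 'I_n.+1, (l <= r.1.2)%N ==>
        (butterfly (s r.1.1) n.+1 z l == insert0 r.1.2 r.2 l)].
      by case: nhit; split=> l il; apply/eqP; [apply: (implyP (zw l))|apply: (implyP (xw l))].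
    move=> /forallPn[l]; rewrite negb_imply => /andP[li ne]; left.
    apply: (@val4_diff_differ _ _ _ _ (rev_ord l)); last by rewrite rev_ordK.
    by rewrite /= leq_sub2l.
  move=> /forallPn[l]; rewrite negb_imply => /andP[li ne]; right.
  exact: (@val4_diff_differ _ _ _ _ l).
have eP r : e r <-> exists z, f (Some z) r < 0.
  have [h1 h2] := butterfly_hit r.1.2 (insert0 r.1.2 r.2) (s_indep r.1.1).
  have sE : ~~ s r.1.1 r.1.2 (insert0 r.1.2 r.2) = e r.
    by rewrite /s insert0K negbK; case: r {h1 h2} => [[]].
  rewrite sE in h1 h2; split=> [/h2[z hz]|[z lt0]]; first by exists z; exact: f_hit.
  apply: h1; exists z; apply: contrapT => /f_miss gt0.
  by move: (lt_trans gt0 lt0); rewrite ltxx.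
pose o (j : 'I_d.+1) := nth None [seq Some z | z <- enum {: {ffun 'I_n.+1 -> bool}}] j.
have size_o : size [seq Some z | z <- enum {: {ffun 'I_n.+1 -> bool}}] = (2 ^ n.+1)%N.
  by rewrite size_map -cardE card_ffun card_bool card_ord.
(* Index [d] is past the end of the list, since [2 ^ n.+1 <= d], so the default [None] is read
   there. *)
have o_max : o ord_max = None by rewrite /o nth_default // size_o.
have o_surj z : exists j, o j = Some z.
  have zin : Some z \in [seq Some z | z <- enum {: {ffun 'I_n.+1 -> bool}}].
    by rewrite map_f // mem_enum.
  have lt_d : (index (Some z) [seq Some z | z <- enum {: {ffun 'I_n.+1 -> bool}}] < d.+1)%N.
    by apply: ltnW; rewrite ltnS; apply: leq_trans nd; rewrite -size_o index_mem.
  by exists (Ordinal lt_d); rewrite /o /= nth_index.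
have nz r j : f (o j) r != 0.
  case: (o j) => [z|]; last by rewrite gt_eqF.
  have [/f_hit/lt_eqF ->//|/f_miss/gt_eqF ->//] := pselect (hit z r).
have [v [v_indep sgn]] := @aff_indep_perturb d _ (fun r => normal_of d r)
  (fun r : box_index m.+1 n => ellipse_const r.1.2 r.2) (fun j => lift_point d (P (o j))) nz.
exists v; split=> // r.
rewrite (@meets_open_simplex _ _ _ _ ord_max); last first.
- by have := sgn r ord_max; rewrite -/(f (o ord_max) r) o_max pmulr_rgt0.
- by move=> j; have := sgn r j; case: eqP => // ->; rewrite mulr0 ltxx.
rewrite eP; split=> [[j lt0]|[z lt0]].
  have lt0' : f (o j) r < 0 by have := sgn r j; rewrite nmulr_lgt0.
  case: (o j) lt0' => [z|]; first by exists z.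
  by move=> /(lt_trans (f_None r)); rewrite ltxx.
have [j oj] := o_surj z; exists j.
by have := sgn r j; rewrite -/(f (o j) r) oj nmulr_rgt0.
Qed.

(** * Counting the hyperplanes *)

Lemma log2_bounds (d k : nat) : (2 ^ k <= d < 2 ^ k.+1)%N ->
  k%:R <= log2 d%:R /\ log2 d%:R <= k.+1%:R.
Proof.
move=> /andP[kd dk].
have ln2 : 0 < Rpower.ln 2.
  rewrite -[0]Rpower.ln_1; apply/RltP/Rpower.ln_increasing; first exact: RIneq.Rlt_0_1.
  by apply/RltP; have : 1 < 2 :> R by lra.
have ln_exp j : Rpower.ln (2 ^ j)%:R = j%:R * Rpower.ln 2.
  by rewrite natrX -RpowE Rpower.ln_pow ?INRE //; apply/RltP.
have le_ln (x y : nat) : (0 < x)%N -> (x <= y)%N -> Rpower.ln x%:R <= Rpower.ln y%:R :> R.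
  move=> x0; rewrite leq_eqVlt => /orP[/eqP -> //|xy].
  by apply/ltW/RltP/Rpower.ln_increasing; apply/RltP; rewrite ?ltr0n ?ltr_nat.
rewrite /log2 ler_pdivlMr // ler_pdivrMr // -!ln_exp; split; apply: le_ln => //.
- by rewrite expn_gt0.
- by apply: leq_trans kd; rewrite expn_gt0.
- exact: ltnW.
Qed.

Lemma card_box_index m n : #|{: box_index m n}| = (m * n.+1 * 2 ^ n)%N.
Proof. by rewrite !card_prod card_ffun card_bool !card_ord. Qed.

Lemma hyperplane_normal_of d m n (r : box_index m.+1 n) (b : R) :
  (4 * m.+1 <= d)%N -> is_hyperplane (fun x => dotp (normal_of d r) x = b).
Proof.
move=> md; exists (normal_of d r), b; split=> //.
have lt_d : (4 * r.1.1 < d)%N by have := ltn_ord r.1.1; lia.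
apply/negP => /eqP/rowP/(_ (Ordinal lt_d)); rewrite !mxE /=.
rewrite mulnC mulnK // modnMl eqxx mul1r /ellipse_coef /=.
by apply/eqP; rewrite invr_eq0 expf_neq0 // gt_eqF // exprn_gt0.
Qed.

Theorem theorem2 :
  exists c C : R, 0 < c /\ 0 < C /\
  forall d : nat, (4 <= d)%N ->
  exists H : (point d -> Prop) -> Prop,
    (forall h, H h -> is_hyperplane h) /\
    (exists Y, simplex_shatters H Y /\
       c * (d%:R) ^+ 2 * log2 d%:R <= (size Y)%:R) /\
    (forall Y, simplex_shatters H Y ->
       (size Y)%:R <= C * (d%:R) ^+ 2 * log2 d%:R).
Proof.
(* Here 56 = 7 * 4 * 2, from [d <= 7 * m.+1], [d <= 4 * 2 ^ n] and [log2 d <= 2 * n.+1]. The upper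
   constant is 1 because [m.+1] and [2 ^ n] are at most [d], and [n.+1] at most [log2 d]. *)
exists 56^-1, 1; split; [by rewrite invr_gt0|split=> // d d4].
have := @trunc_log_bounds 2 d isT (leq_trans (isT : 0 < 4)%N d4).
have : (1 < trunc_log 2 d)%N by apply: (@leq_trans (trunc_log 2 4)) => //; exact: leq_trunc_log.
case: (trunc_log 2 d) => [//|n] n1 /= bnd.
have [/= L1 L2] := log2_bounds bnd; case/andP: bnd => nd dn.
have [m mE] : exists m, (d %/ 4 = m.+1)%N by exists (d %/ 4).-1; lia.
have md : (4 * m.+1 <= d)%N by lia.
pose h (r : box_index m.+1 n) (x : point d) := dotp (normal_of d r) x = ellipse_const r.1.2 r.2.
have trace e := @simplices_trace d m n e md nd.
have h_inj : injective h.
  (* The simplex realizing the singleton of [r] meets [h r] but no [h r'] with another index. *)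
  move=> r r' hh; apply/eqP; have [v [_ vP]] := trace (eq_op r).
  by rewrite -vP -/(h r') -hh vP.
pose Y := List.map h (enum {: box_index m.+1 n}).
have InY r : List.In (h r) Y.
  apply: List.in_map; have : r \in enum {: box_index m.+1 n} by rewrite mem_enum.
  by elim: (enum _) => //= r' s IH; rewrite inE => /orP[/eqP ->|/IH]; [left|right].
have YIn g : List.In g Y -> exists r, g = h r.
  by move=> /List.in_map_iff[r [<- _]]; exists r.
have uY : List.NoDup Y.
  apply: List.NoDup_map_NoDup_ForallPairs => [r r' _ _ /h_inj //|].
  have := enum_uniq {: box_index m.+1 n}; elim: (enum _) => [|r s IH /= /andP[rs us]].
    by constructor.
  constructor; last exact: IH.
  move=> rIn; case/negP: rs; elim: s rIn {IH us} => //= r' s IH.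
  by case=> [->|/IH rs]; rewrite inE ?eqxx ?rs ?orbT.
have sizeY : size Y = (m.+1 * n.+1 * 2 ^ n)%N.
  by rewrite -card_box_index cardE /Y -[size _]/(length _) List.length_map.
exists (fun g => List.In g Y); split; [|split].
- by move=> g /YIn[r ->]; exact: hyperplane_normal_of.
- exists Y; split.
    split=> //; split=> // Q.
    have [v [v_indep vP]] := trace (fun r => `[< Q (h r) >]).
    exists (open_simplex_of v); split; first by exists v.
    by move=> g /YIn[r ->]; rewrite vP asboolE.
  rewrite sizeY.
  have [a7 b4] : (d <= 7 * m.+1 /\ d <= 4 * 2 ^ n)%N by move: dn; rewrite !expnS; lia.
  have : d%:R <= 7 * m.+1%:R :> R by rewrite -natrM ler_nat.
  have : d%:R <= 4 * (2 ^ n)%:R :> R by rewrite -natrM ler_nat.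
  have : log2 d%:R <= 2 * n.+1%:R by apply: (le_trans L2); rewrite -natrM ler_nat; lia.
  rewrite !natrM; have : 0 <= log2 d%:R by exact: le_trans L1.
  have : 0 <= d%:R :> R by [].
  move: (d%:R) (log2 _) m.+1%:R n.+1%:R (2 ^ n)%:R => x L a b c x0 L0 h1 h2 h3.
  have : x * x <= (7 * a) * (4 * c) by apply: ler_pM.
  have : 0 <= x * x by exact: mulr_ge0.
  move=> xx h4; have : (x * x) * L <= ((7 * a) * (4 * c)) * (2 * b) by apply: ler_pM.
  by rewrite expr2; lra.
- move=> Y' [uY' [sub _]].
  have /ssrnat.leP le_Y : (length Y' <= length Y)%coq_nat by exact: List.NoDup_incl_length.
  have {}le_Y : (size Y' <= size Y)%N by [].
  apply: (@le_trans _ _ (size Y)%:R); first by rewrite ler_nat.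
  have le_m : m.+1%:R <= d%:R :> R by rewrite ler_nat; lia.
  have le_n : (2 ^ n)%:R <= d%:R :> R by rewrite ler_nat; move: nd; rewrite expnS; lia.
  rewrite sizeY mul1r expr2 mulrAC !natrM.
  by apply: ler_pM => //; rewrite ?mulr_ge0 //; apply: ler_pM.
Qed.
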